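(* Let $\varepsilon>0$, $Q\in\mathbb{N}$ and $0<\Delta\le 1/2$; put $\tau=\Delta^{-1/2}$. For $\alpha\in\mathbb{R}$ let \[ P(\alpha)=\#\{(q,a)\in\mathbb{Z}^2:\ Q<q\le 2Q,\ (a,q)=1,\ |a/q^2-\alpha|\le\Delta\}. \] Suppose $\alpha=\frac{b}{r}+z$ with $r\in\mathbb{N}$, $r\le\tau$, $b\in\mathbb{Z}$, $(b,r)=1$ and $|z|\le \frac{1}{r\tau}$. Then \[ P(\alpha)\ll Q^3\Delta+(Q\Delta^{-1})^{\varepsilon}\left(\frac{Q}{\sqrt{r}}+\sqrt{Q}+Q\sqrt{r\Delta}+Q^{3/2}\sqrt{\Delta}\right), \] where the implied constant depends on $\varepsilon$ alone. *)

(* Defs.v *)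
From HB Require Import structures.
From mathcomp Require Export all_boot all_order all_algebra finmap.
From mathcomp Require Export all_classical all_reals all_analysis.
Set Implicit Arguments.
Unset Strict Implicit.
Unset Printing Implicit Defensive.
Import Order.TTheory GRing.Theory Num.Theory.
Local Open Scope classical_set_scope.
Local Open Scope ring_scope.

(* The pairs are (q, a), in this order. *)
Definition square_farey_near (R : realType) (Q : nat) (Delta alpha : R) :
    set (int * int) :=
  [set qa | [/\ Q%:Z < qa.1 <= (2 * Q)%N%:Z,
                coprimez qa.2 qa.1 &
                `|qa.2%:~R / qa.1%:~R ^+ 2 - alpha| <= Delta]].

Lemma finite_square_farey_near (R : realType) (Q : nat) (Delta alpha : R) :
  finite_set (square_farey_near Q Delta alpha).
Proof.
have fin_int (M : nat) : finite_set [set x : int | `|x| <= M%:Z].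
  apply: (@sub_finite_set _ _
    ((fun n : nat => n%:Z) @` `I_M.+1 `|` (fun n : nat => - n%:Z) @` `I_M.+1)).
    move=> [n|n] /= nM; first by left; exists n => //=; rewrite ltnS.
    by right; exists n.+1.
  by rewrite finite_setU; split; apply: finite_image; apply: finite_II.
pose B : R := (`|alpha| + `|Delta|) * (2 * Q)%N%:R ^+ 2.
pose M := (Num.bound B).
apply: (@sub_finite_set _ _
  ([set x : int | `|x| <= (2 * Q)%N%:Z] `*` [set x : int | `|x| <= M%:Z])).
  move=> [q a] [/= /andP[Qq qQ] _ aq]; have q0 : 0 < q by apply: le_lt_trans Qq.
  split => /=; first by rewrite gtr0_norm.
  rewrite -(ler_int R) intr_norm.
  have qR0 : 0 < q%:~R :> R by rewrite ltr0z.
  have -> : a%:~R = a%:~R / q%:~R ^+ 2 * q%:~R ^+ 2 :> R.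
    by rewrite divfK // expf_neq0 // gt_eqF.
  apply: (@le_trans _ _ B); last first.
    by rewrite ltW // archi_boundP // /B mulr_ge0 ?addr_ge0 ?exprn_ge0 //.
  rewrite normrM (ger0_norm (ltW (exprn_gt0 2 qR0))) /B.
  apply: ler_pM => //; first by rewrite exprn_ge0 // ltW.
    rewrite -[X in `|X|](subrK alpha) (le_trans (ler_normD _ _)) // addrC lerD2l.
    exact: le_trans aq (ler_norm _).
  apply: lerXn2r; rewrite ?nnegrE ?(ltW qR0) //.
  by rewrite -[_%:R]/((2 * Q)%N%:~R) ler_int.
by apply: finite_setX.
Qed.

(* Meaningful as a cardinality because the set is always finite
   (finite_square_farey_near). *)
Definition Pcount (R : realType) (Q : nat) (Delta alpha : R) : nat :=
  #|` fset_set (square_farey_near Q Delta alpha)|%fset.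

(* Main.v *)
(* Put [delta = 4 Q^2 Delta]. If [delta > 1/8], counting the integers in
   intervals of length [2 delta] suffices. Otherwise every [q] admits at most
   one [a], and it remains to count the [q] for which [alpha q^2] lies within
   [delta] of an integer. Bounding the indicator by the Fejer kernel of length
   [H ~ 1 / (8 delta)] gives
     [P <= 4 Q / H + (8 / H) sum_(0 < k < H) |S k|],
   with [S k] the sum of [cos (2 pi k alpha q^2)]. By Cauchy's inequality and
   Weyl differencing, the square of the last term is controlled by
     [sum_(k, l) min (Q, 1 / |sin (2 pi k l alpha)|)];
   collecting the pairs with the same product [m = 2 k l] costs a divisor bound
   [m^eps], and the sum over [m < 2 H Q] is handled with the rational
   approximation [b / r] to [alpha]. *)
Require Import Defs.
From mathcomp Require Import ring lra zify.
Set Implicit Arguments.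
Unset Strict Implicit.
Unset Printing Implicit Defensive.
Import Order.TTheory GRing.Theory Num.Theory.
Import numFieldNormedType.Exports.
Local Open Scope ring_scope.

(** * Trigonometric sums *)

Lemma sin_le_id (R : realType) (x : R) : 0 <= x -> sin x <= x.
Proof.
move=> x0.
have [|c _ e] := @MVT_segment R sin cos 0 x x0.
  by apply: continuous_subspaceT; apply: continuous_sin.
rewrite sin0 !subr0 in e.
by rewrite e ler_piMl // cos_le1.
Qed.

(** By the half-angle formula [cos x] is [1 - 2 sin(x/2)^2], and [sin (x / 2) <= x / 2]. Squaring
    this needs a nonnegative sine, hence the separate case [x >= 2], where the quadratic is at most
    [-1]. *)
Lemma cos_ge_quad (R : realType) (x : R) : 1 - x ^+ 2 / 2 <= cos x.
Proof.
wlog x0 : x / 0 <= x => [H|].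
  by have [/H//|/ltW x0] := leP 0 x; rewrite -cosN -sqrrN; apply: H; rewrite oppr_ge0.
have [x4|x4] := leP 2 x.
  apply: (@le_trans _ _ (-1)); last exact: cos_geN1.
  have : 2 * 2 <= x * x by apply: ler_pM.
  by rewrite expr2; lra.
have s0 : 0 <= sin (x / 2) by apply: sin_ge0_pi; have := pi_ge2 R; lra.
have s1 : sin (x / 2) <= x / 2 by apply: sin_le_id; lra.
have -> : x = (x / 2) *+ 2 by rewrite -mulr_natr; field.
rewrite cos_mulr2n cos2sin2; set s := sin _ in s0 s1 *; set u := x / 2 in s1 *.
have : s * s <= u * u by apply: ler_pM.
by rewrite !expr2; lra.
Qed.

(** Here [sin x = 2 sin(x/2) cos(x/2)], and the mean value theorem turns [sin (x / 2)] into
    [cos c * (x / 2)]. Both cosines have arguments in [[0, 1]], so each is at least [1 / 2]. *)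
Lemma sin_ge_quarter (R : realType) (x : R) : 0 <= x <= 2 -> x / 4 <= sin x.
Proof.
move=> /andP[x0 x2].
have u0 : 0 <= x / 2 by lra.
have [|c cI e] := @MVT_segment R sin cos 0 (x / 2) u0.
  by apply: continuous_subspaceT; apply: continuous_sin.
rewrite sin0 !subr0 in e.
have half (v : R) : 0 <= v -> v <= 1 -> 1 / 2 <= cos v.
  move=> v0 v1; apply: le_trans (cos_ge_quad v).
  have : v * v <= 1 * 1 by apply: ler_pM.
  by rewrite expr2; lra.
have c0 : 1 / 2 <= cos c.
  by move: cI; rewrite in_itv /= => /andP[c0 c1]; apply: half => //; lra.
have c1 : 1 / 2 <= cos (x / 2) by apply: half; lra.
have -> : x = (x / 2) *+ 2 by rewrite -mulr_natr; field.
rewrite sin_mulr2n e mulrA.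
have : (1 / 2) * (1 / 2) * (x / 2) <= cos (x / 2) * cos c * (x / 2).
  by apply: ler_wpM2r => //; apply: ler_pM => //; lra.
lra.
Qed.

Lemma cosD2pin (R : realType) (n : int) (x : R) : cos (x + 2 * pi * n%:~R) = cos x.
Proof.
wlog n0 : n x / 0 <= n => [H|].
  have [/H//|/ltW n0] := leP 0 n; rewrite -(H (- n)) ?oppr_ge0 //; congr cos.
  by rewrite mulrNz; ring.
case: n n0 => // n _.
have -> : 2 * pi * (Posz n)%:~R = (pi *+ 2) *+ n :> R.
  by rewrite -pmulrn -[RHS]mulr_natr -mulr_natr; ring.
exact: periodicn (@cosD2pi R) n x.
Qed.

(* Multiplying by [2 sin (u / 2)] makes the sum telescope. *)
Lemma norm_sum_cos_le (R : realType) (N : nat) (u b : R) :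
  `|\sum_(0 <= i < N) cos (i%:R * u + b)| * `|sin (u / 2)| <= 1.
Proof.
rewrite -normrM.
have -> : (\sum_(0 <= i < N) cos (i%:R * u + b)) * sin (u / 2) =
   (sin (N%:R * u + b - u / 2) - sin (b - u / 2)) / 2.
  elim: N => [|N IH].
    by rewrite big_geq // mul0r mul0r add0r subrr mul0r.
  rewrite big_nat_recr //= mulrDl {}IH.
  have -> : N.+1%:R * u + b - u / 2 = (N%:R * u + b) + u / 2 :> R.
    by rewrite -natr1; field.
  set A := _ + b; set v := u / 2.
  by rewrite (sinD A v) (sinB A v); set S := sin (b - v); field.
rewrite normrM normfV (ger0_norm (_ : 0 <= 2)) // ler_pdivrMr // mul1r.
apply: le_trans (ler_normB _ _) _.
by rewrite -[2]/(1 + 1); apply: lerD; apply: sin_max.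
Qed.

(** This is the squared modulus of an exponential sum, expanded in real form and sorted by the shift
    [l]. It serves twice: with linear phases for the Fejer kernel and with quadratic phases for Weyl
    differencing. *)
Lemma sqr_sum_phase (R : realType) (N : nat) (x : nat -> R) :
  (\sum_(0 <= i < N) cos (x i)) ^+ 2 + (\sum_(0 <= i < N) sin (x i)) ^+ 2 =
  N%:R + 2 * \sum_(1 <= l < N) \sum_(0 <= i < N - l) cos (x (i + l)%N - x i).
Proof.
elim: N => [|N IH]; first by rewrite !big_geq // !expr0n /= !mulr0 !addr0.
rewrite [\sum_(0 <= i < _) cos (x i)]big_nat_recr //= [\sum_(0 <= i < _) sin (x i)]big_nat_recr //=.
set c := \sum_(0 <= i < N) cos _ in IH *; set s := \sum_(0 <= i < N) sin _ in IH *.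
have -> : (c + cos (x N)) ^+ 2 + (s + sin (x N)) ^+ 2 =
    (c ^+ 2 + s ^+ 2) + 2 * (c * cos (x N) + s * sin (x N))
    + (cos (x N) ^+ 2 + sin (x N) ^+ 2) by ring.
rewrite {}IH cos2Dsin2 -natr1.
(* Adjoining the index [N] adds the pairs [(i, N)] with [i < N], exactly one for each shift
   [l = N - i]. *)
have -> : \sum_(1 <= l < N.+1) \sum_(0 <= i < N.+1 - l) cos (x (i + l)%N - x i) =
    \sum_(1 <= l < N) \sum_(0 <= i < N - l) cos (x (i + l)%N - x i) +
    (c * cos (x N) + s * sin (x N)); last by ring.
rewrite /c /s !big_distrl -big_split /=.
case: N {c s} => [|N]; first by rewrite !big_geq // addr0.
transitivity (\sum_(1 <= l < N.+2) (\sum_(0 <= i < N.+1 - l) cos (x (i + l)%N - x i)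
    + cos (x N.+1 - x (N.+1 - l)%N))).
  apply: eq_big_nat => l /andP[l1 l2]; rewrite subSn // big_nat_recr //=.
  by rewrite subnK.
rewrite big_split /= big_nat_recr //= subnn [X in _ + X + _]big_geq // addr0; congr (_ + _).
rewrite big_add1 /= big_nat_rev /=; apply: eq_big_nat => i /andP[_ iN].
have -> : (N.+1 - (0 + N.+1 - i.+1).+1 = i)%N by lia.
by rewrite cosB mulrC [sin _ * _]mulrC.
Qed.

(** * The divisor bound *)

(** [divisors] folds over the prime decomposition. For each prime [p] there are [logn p n] merging
    rounds, and each lengthens the list by its size before [p] was treated. *)
Lemma size_divisors (n : nat) :
  size (divisors n) = (\prod_(p <- primes n) (logn p n).+1)%N.
Proof.
rewrite /divisors prime_decompE foldr_map /=.
elim: (primes n) => [|p s IH]; first by rewrite big_nil.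
rewrite big_cons -IH /=; move: (foldr _ _ s) => z.
elim: (logn p n) => [|e IHe]; first by rewrite mul1n.
by rewrite iterS size_merge size_cat size_map IHe mulSn addnC [in RHS]mulSn.
Qed.

Lemma bernoulli_ineq (R : realDomainType) (x : R) (n : nat) :
  0 <= x -> 1 + n%:R * x <= (1 + x) ^+ n.
Proof.
move=> x0; elim: n => [|n IH]; first by rewrite mul0r addr0 expr0.
rewrite exprS; apply: le_trans (_ : (1 + x) * (1 + n%:R * x) <= _).
  have : 0 <= n%:R * x * x by rewrite !mulr_ge0.
  by rewrite -natr1; lra.
by rewrite ler_wpM2l // addr_ge0.
Qed.

Lemma powR_expr (R : realType) (x e : R) (k : nat) :
  0 <= x -> (x ^+ k) `^ e = (x `^ e) ^+ k.
Proof.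
move=> x0; elim: k => [|k IH]; first by rewrite !expr0 powR1.
by rewrite !exprS powRM ?exprn_ge0 // IH.
Qed.

(* Only the primes below [2 `^ e^-1] contribute a factor exceeding
   [(p ^ k) `^ e] to the number of divisors. *)
Lemma divisor_bound (R : realType) (e : R) : 0 < e ->
  exists2 B : R, 1 <= B &
    forall n : nat, (0 < n)%N -> (size (divisors n))%:R <= B * n%:R `^ e.
Proof.
move=> e0.
(* Every [p >= K] exceeds [2^(1/e)], so that [p^e >= 2]. *)
pose K := (Num.truncn ((2 : R) `^ e^-1)).+1.
pose x : R := 2 `^ e - 1.
have x0 : 0 < x.
  have one_e : 1 = 1 `^ e :> R by rewrite powR1.
  rewrite subr_gt0 [ltLHS]one_e.
  by apply: gt0_ltr_powR => //; rewrite ?nnegrE ?ler01 // ltr1n.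
(* The choice gives [B (1 + k x) = 1 + k + 1/x + k x >= k + 1], while
   [1 + k x <= (1 + x)^k = 2^(e k)] by Bernoulli. This settles the small primes. *)
pose B : R := 1 + x^-1.
have B1 : 1 <= B by rewrite lerDl invr_ge0 ltW.
exists (B ^+ K); first exact: exprn_ege1.
move=> n n0; rewrite size_divisors.
have nE : n%:R `^ e = \prod_(p <- primes n) (p%:R `^ e) ^+ logn p n :> R.
  rewrite {1}(prod_prime_decomp n0) prime_decompE big_map /=.
  elim: (primes n) => [|p s IH]; first by rewrite !big_nil powR1.
  by rewrite !big_cons natrM powRM // IH natrX powR_expr.
have BK : \prod_(p <- primes n) (if (p < K)%N then B else 1) <= B ^+ K.
  rewrite -big_mkcond big_const_seq /= iter_mulr_1 ler_weXn2l //.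
  rewrite -size_filter -[leqRHS](size_iota 0 K); apply: uniq_leq_size.
    by rewrite filter_uniq ?primes_uniq.
  by move=> p; rewrite mem_filter mem_iota => /andP[].
rewrite nE natr_prod.
apply: le_trans (ler_wpM2r _ BK); last first.
  by apply: prodr_ge0 => p _; rewrite exprn_ge0 ?powR_ge0.
rewrite -big_split /= big_seq [leRHS]big_seq; apply: ler_prod => p pn.
rewrite ler0n /=; move: pn; rewrite mem_primes => /andP[/prime_gt1 p1 _].
have pe : 2 `^ e <= p%:R `^ e.
  by apply: ge0_ler_powR; rewrite ?nnegrE ?ler0n ?ler_nat // ltW.
set k := logn p n.
case: ifP => [_|/negbT]; last rewrite -leqNgt => Kp.
  have Bk : k.+1%:R <= B * (1 + k%:R * x).
    have -> : B * (1 + k%:R * x) = 1 + k%:R + x^-1 + k%:R * x by rewrite /B; field; rewrite gt_eqF.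
    rewrite -natr1 addrC -addrA lerDl addr_ge0 ?invr_ge0 ?mulr_ge0 //; exact: ltW.
  apply: (le_trans Bk); rewrite ler_wpM2l //; first by rewrite (le_trans ler01).
  apply: le_trans (bernoulli_ineq _ (ltW x0)) _.
  by rewrite lerXn2r ?nnegrE ?powR_ge0 // addrC subrK.
rewrite mul1r.
(* For large primes no constant is lost, since [k + 1 <= 2^k]. *)
have p2 : 2 <= p%:R `^ e :> R.
  have -> : 2 = (2 `^ e^-1) `^ e :> R by rewrite -powRrM mulVf ?powRr1 // gt_eqF.
  apply: ge0_ler_powR; rewrite ?nnegrE ?powR_ge0 //; first exact: ltW.
  by apply/ltW/(lt_le_trans (truncnS_gt _)); rewrite ler_nat.
apply: (@le_trans _ _ (2 ^+ k)).
  have := @bernoulli_ineq R 1 k ler01.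
  by rewrite mulr1 -natr1 addrC.
by rewrite lerXn2r ?nnegrE ?powR_ge0.
Qed.

(** The inductive step is [ln (1 - 1/m) <= -1/m], applied to the ratio of consecutive integers. *)
Lemma harmonic_le_ln (R : realType) (n : nat) : (0 < n)%N ->
  \sum_(1 <= t < n.+1) t%:R^-1 <= 1 + ln n%:R :> R.
Proof.
case: n => // n _; elim: n => [|n IH].
  by rewrite big_nat1 invr1 ln1 addr0.
rewrite big_nat_recr //=; apply: le_trans (lerD IH (lexx _)) _.
rewrite -addrA lerD2l.
have -> : n.+1%:R = n.+2%:R * (1 + - n.+2%:R^-1) :> R.
  by rewrite mulrDr mulrN mulfV // mulr1 -[n.+2%:R]natr1 addrK.
have h : 0 < 1 + - (n.+2%:R : R)^-1.
  by rewrite subr_gt0 invf_lt1 // ltr1n.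
rewrite lnM ?posrE //.
have := @le_ln1Dx R (- n.+2%:R^-1); rewrite -subr_gt0 opprK [X in 0 < X]addrC => /(_ h) H.
set a := ln n.+2%:R in H *; set b := ln _ in H *; set c := _^-1 in H *. lra.
Qed.

(** Apply [ln y < y] to the power [y = x^e]. *)
Lemma ln_le_powR (R : realType) (e x : R) : 0 < e -> 0 < x -> ln x <= e^-1 * x `^ e.
Proof.
move=> e0 x0; rewrite ler_pdivlMl // -ln_powR.
by apply/ltW/ln_sublinear/powR_gt0.
Qed.

(** * Sums over multiples of [alpha] *)

(** The left side is half the distance to the nearest integer. Periodicity and the reflection
    [y -> 1 - y] reduce to [y <= 1 / 2], where [sin (pi y) >= pi y / 4 >= y / 2]. *)
Lemma abs_sin_pi_ge (R : realType) (y : R) (n : int) : 0 <= y <= 1 ->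
  Num.min y (1 - y) / 2 <= `|sin (pi * (y + n%:~R))|.
Proof.
move=> /andP[y0 y1].
have sinDpin (x : R) : `|sin (x + pi * n%:~R)| = `|sin x|.
  have nat_case (k : nat) (v : R) : `|sin (v + pi * k%:R)| = `|sin v|.
    rewrite mulr_natr (alternatingn (@sinDpi R)) normrM normrX normrN1.
    by rewrite expr1n mul1r.
  case: n => k; first exact: nat_case.
  by rewrite NegzE -[in RHS](subrK (pi * k.+1%:R) x) nat_case mulrNz mulrN.
rewrite mulrDr sinDpin.
have pi2 := pi_ge2 R; have pih := pihalf_lt2 R.
have key (u : R) : 0 <= u -> u <= 1 / 2 -> u / 2 <= sin (pi * u).
  move=> u0 u1; apply: le_trans (sin_ge_quarter _); nra.
apply: le_trans (ler_norm _).
case: (leP y (1 - y)) => h; first by apply: key => //; lra.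
have -> : sin (pi * y) = sin (pi * (1 - y)) :> R.
  have -> : pi * (1 - y) = - (pi * y) + pi :> R by ring.
  by rewrite sinDpi sinN opprK.
apply: key; lra.
Qed.

Section Buckets.
Variables (R : realType) (alpha z : R) (b : int) (r : nat).
Hypotheses (alphaE : alpha = b%:~R / r%:R + z) (r0 : (0 < r)%N)
  (cbr : coprimez b r%:Z) (zr : `|z| <= (r%:R ^+ 2)^-1).

Let fracpart (m : nat) : R := m%:R * alpha - (Num.floor (m%:R * alpha))%:~R.
Let bucket (m : nat) : nat := Num.truncn (2 * r%:R * fracpart m).

Let rR0 : 0 < r%:R :> R. Proof. by rewrite ltr0n. Qed.

Let frac_itv m : 0 <= fracpart m < 1.
Proof.
have /andP[h1 h2] := floor_itv (m%:R * alpha).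
by move: h2; rewrite intrD1 /fracpart => h2; apply/andP; split; lra.
Qed.

Let bucket_itv m :
  (bucket m)%:R <= 2 * r%:R * fracpart m < (bucket m).+1%:R.
Proof.
apply: truncn_itv; have /andP[h _] := frac_itv m.
by rewrite !mulr_ge0.
Qed.

Let bucket_lt m : (bucket m < 2 * r)%N.
Proof.
have /andP[h1 _] := bucket_itv m; have /andP[_ h2] := frac_itv m.
rewrite -(ltr_nat R) natrM (le_lt_trans h1) //.
by rewrite -[ltRHS]mulr1 ltr_pM2l // mulr_gt0.
Qed.

(** In a common bucket the fractional parts differ by less than [1 / (2 r)], and [d |z|] is less
    than [1 / (2 r)] too. Hence the integer [d b - N r] has absolute value below [1] and vanishes;
    by coprimality [r] divides [d], which is too small. *)
Let bucket_inj m d : (0 < d)%N -> (2 * d < r)%N -> bucket m != bucket (m + d).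
Proof.
move=> d0 dr; apply/eqP => e.
have /andP[h1 h2] := bucket_itv m.
have := bucket_itv (m + d)%N; rewrite -e => /andP[h3 h4].
rewrite -natr1 in h2 h4.
set N := Num.floor ((m + d)%:R * alpha) - Num.floor (m%:R * alpha).
have fE : fracpart (m + d) - fracpart m = (d%:Z * b - N * r%:Z)%:~R / r%:R + d%:R * z.
  rewrite /fracpart /N !intrD mulrNz !intrM intrD mulrNz alphaE natrD /=.
  rewrite -!pmulrn; field; exact: lt0r_neq0.
have dz : `|d%:R * z| <= d%:R / r%:R ^+ 2.
  by rewrite normrM ger0_norm // ler_wpM2l.
have dz2 : d%:R / r%:R ^+ 2 * (2 * r%:R) < 1 :> R.
  have -> : d%:R / r%:R ^+ 2 * (2 * r%:R) = (2 * d)%:R / r%:R :> R.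
    by rewrite natrM; field; exact: lt0r_neq0.
  by rewrite ltr_pdivrMr // mul1r ltr_nat.
have small : `|(d%:Z * b - N * r%:Z)%:~R : R| < 1.
  set k : R := _%:~R in fE *.
  have kE : 2 * k = 2 * r%:R * (fracpart (m + d) - fracpart m) - (d%:R * z) * (2 * r%:R).
    by rewrite fE; field; exact: lt0r_neq0.
  have : `|d%:R * z * (2 * r%:R)| < 1.
    rewrite normrM [X in _ * X]ger0_norm ?mulr_ge0 //.
    by apply: le_lt_trans dz2; rewrite ler_wpM2r ?mulr_ge0.
  rewrite ltr_norml => /andP[h5 h6].
  by rewrite ltr_norml; apply/andP; split; lra.
have : d%:Z * b - N * r%:Z = 0.
  apply/eqP; rewrite -absz_eq0 -leqn0 -ltnS.
  by rewrite -ltz_nat abszE -(ltr_int R) intr_norm.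
move/eqP; rewrite subr_eq0 => /eqP dbN.
have : (r%:Z %| d%:Z * b)%Z by rewrite dbN dvdz_mull.
rewrite Gauss_dvdzl; last by rewrite coprimez_sym.
move/(dvdn_leq d0); clear -d0 dr; lia.
Qed.

Variables (g : nat -> R) (X c : R).
Hypotheses (X0 : 0 <= X) (c0 : 0 <= c) (gX : forall m, g m <= X) (g0 : forall m, 0 <= g m)
  (gsin : forall m, g m * `|sin (pi * (m%:R * alpha))| <= c).

(** At distance at least [t / (2 r)] from the integers the sine is at least [t / (4 r)], which
    bounds [g] by [4 r c / t]. Next to an integer, [t = 0], only the bound [X] is left. *)
Let h (t : nat) : R := if t == 0%N then X else 4 * r%:R * c / t%:R.

Let h_ge0 t : 0 <= h t.
Proof. by rewrite /h; case: eqP => // _; rewrite !mulr_ge0 ?invr_ge0. Qed.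

(** Bucket [j] is at distance at least [j / (2 r)] from [0] and [(2 r - j - 1) / (2 r)] from [1].
    Adding the bounds for both ends avoids recording which one is nearer. *)
Let g_le_h m : g m <= h (bucket m) + h (2 * r - (bucket m).+1).
Proof.
have /andP[f0 f1] := frac_itv m.
have /andP[b1 b2] := bucket_itv m.
have bl := bucket_lt m.
have hs : Num.min (fracpart m) (1 - fracpart m) / 2 <= `|sin (pi * (m%:R * alpha))|.
  have := @abs_sin_pi_ge R (fracpart m) (Num.floor (m%:R * alpha)).
  by rewrite /fracpart subrK; apply; rewrite -/(fracpart m) f0 ltW.
have main (u : nat) : u%:R <= 2 * r%:R * Num.min (fracpart m) (1 - fracpart m) -> g m <= h u.
  rewrite /h; case: eqP => // /eqP u0 hu.
  rewrite ler_pdivlMr ?ltr0n ?lt0n //.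
  have := g0 m; have := gsin m; move: hs hu.
  set s := `|_|; set mm := Num.min _ _; move=> hs hu gs gm.
  have h1 : u%:R <= 4 * r%:R * s.
    by apply: (le_trans hu); move: rR0; nra.
  apply: (@le_trans _ _ (g m * (4 * r%:R * s))); first by rewrite ler_wpM2l.
  have -> : g m * (4 * r%:R * s) = 4 * r%:R * (g m * s) by ring.
  by rewrite ler_wpM2l // mulr_ge0.
case: (leP (fracpart m) (1 - fracpart m)) main => hm main.
  by apply: le_trans (main _ b1) _; rewrite lerDl.
apply: (@le_trans _ _ (h (2 * r - (bucket m).+1))); last by rewrite lerDr.
apply: main; rewrite natrB // natrM; lra.
Qed.

(** The buckets met are distinct, so the block is dominated by the sum over all [2 r] buckets, in
    which each end contributes [X] plus a harmonic sum. *)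
Let block_sum m0 :
  \sum_(m0 <= m < m0 + uphalf r) g m <= 2 * X + 8 * r%:R * c * (1 + ln (2 * r%:R)).
Proof.
pose H t := h t + h (2 * r - t.+1).
have H0 t : 0 <= H t by rewrite addr_ge0.
apply: (@le_trans _ _ (\sum_(m0 <= m < m0 + uphalf r) H (bucket m))).
  by apply: ler_sum => m _; exact: g_le_h.
rewrite /index_iota addKn -(big_map bucket xpredT H).
set s := map _ _.
have us : uniq s.
  rewrite map_inj_in_uniq ?iota_uniq // => m m'; rewrite !mem_iota.
  wlog le_m : m m' / (m <= m')%N.
    move=> W hm hm' e; have [mm|/ltnW mm] := leqP m m'; first exact: W.
    by rewrite (W m' m).
  move=> hm hm' e; have [//|mm] := eqVneq m m'.
  have := @bucket_inj m (m' - m); rewrite subnKC // e eqxx => /(_ _ _)/implyP.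
  lia.
have ss : {subset s <= iota 0 (2 * r)}.
  by move=> t /mapP[m _ ->]; rewrite mem_iota add0n bucket_lt.
have sp : perm_eq s [seq t <- iota 0 (2 * r) | t \in s].
  apply: uniq_perm => //; first by rewrite filter_uniq ?iota_uniq.
  move=> t; rewrite mem_filter; apply/idP/andP => [ts|[]//]; split=> //; exact: ss.
rewrite (perm_big _ sp) big_filter /=.
apply: (@le_trans _ _ (\sum_(t <- iota 0 (2 * r)) H t)).
  by rewrite big_mkcond; apply: ler_sum => t _; case: ifP.
have -> : iota 0 (2 * r) = index_iota 0 (2 * r) by rewrite /index_iota subn0.
rewrite big_split /=.
have -> : \sum_(0 <= t < 2 * r) h (2 * r - t.+1) = \sum_(0 <= t < 2 * r) h t.
  by rewrite [RHS]big_nat_rev /=; apply: eq_big_nat => t _; rewrite add0n.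
have hsum : \sum_(0 <= t < 2 * r) h t <= X + 4 * r%:R * c * (1 + ln (2 * r%:R)).
  rewrite big_ltn ?muln_gt0 // lerD2l.
  have -> : \sum_(1 <= t < 2 * r) h t = 4 * r%:R * c * \sum_(1 <= t < 2 * r) t%:R^-1.
    rewrite big_distrr /=; apply: eq_big_nat => t /andP[t1 _].
    by rewrite /h; case: t t1.
  rewrite ler_wpM2l ?mulr_ge0 //.
  have := @harmonic_le_ln R (2 * r); rewrite muln_gt0 r0 natrM => /(_ isT).
  apply: le_trans; rewrite [leRHS]big_nat_recr ?muln_gt0 //=.
  by rewrite lerDl invr_ge0.
lra.
Qed.

(* In [uphalf r] consecutive values of [m], the integer parts of
   [2 r {m alpha}] are pairwise distinct. *)
Lemma sum_min_inv_sin_le (M : nat) :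
  \sum_(0 <= m < M) g m <=
    (2 * M%:R / r%:R + 1) * (2 * X + 8 * r%:R * c * (1 + ln (2 * r%:R))).
Proof.
(* Since [L >= r / 2], at most [2 M / r + 1] blocks cover the range; the last may overrun [M], which
   is harmless as [g >= 0]. *)
pose L := uphalf r; have L0 : (0 < L)%N by rewrite /L; lia.
pose n := (M %/ L).+1.
set B := 2 * X + _.
have B0 : 0 <= B.
  apply: le_trans (block_sum 0); apply: sumr_ge0 => i _; exact: g0.
have blocks k : \sum_(0 <= m < k * L) g m <= k%:R * B.
  elim: k => [|k IH]; first by rewrite big_geq // mul0r.
  rewrite mulSn addnC (big_cat_nat (n := (k * L)%N)) ?leq_addr //=.
  by rewrite -natr1 mulrDl mul1r lerD // block_sum.
apply: (@le_trans _ _ (\sum_(0 <= m < n * L) g m)).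
  rewrite [leRHS](big_cat_nat (n := M)) //=; last by rewrite ltnW // /n ltn_ceil.
  by rewrite lerDl sumr_ge0.
apply: le_trans (blocks n) _; rewrite ler_wpM2r //.
have -> : n%:R = (M %/ L)%:R + 1 :> R by rewrite natr1.
rewrite lerD2r.
rewrite ler_pdivlMr // -natrM -natrM ler_nat.
have := leq_trunc_div M L; rewrite /L; nia.
Qed.

End Buckets.

(** * Weyl differencing *)

(** Sort the pairs by [m = 2 k l]. In each class [k] divides [m] and determines [l = m / (2 k)], so
    a class has at most as many pairs as [m] has divisors. *)
Lemma sum_mul_pairs_le (R : realDomainType) (G : nat -> R) (D : R) (H Q : nat) :
  (forall m, 0 <= G m) -> 0 <= D ->
  (forall m, (0 < m < 2 * H * Q)%N -> (size (divisors m))%:R <= D) ->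
  \sum_(1 <= k < H) \sum_(1 <= l < Q) G (2 * (k * l))%N <=
    D * \sum_(0 <= m < 2 * H * Q) G m.
Proof.
move=> G0 D0 HD; set M := (2 * H * Q)%N.
have -> : \sum_(1 <= k < H) \sum_(1 <= l < Q) G (2 * (k * l))%N =
    \sum_(1 <= m < M) \sum_(1 <= k < H) \sum_(1 <= l < Q)
      (if (m == 2 * (k * l))%N then G m else 0).
  rewrite [RHS]exchange_big /=; apply: eq_big_nat => k /andP[k1 k2].
  rewrite [RHS]exchange_big /=; apply: eq_big_nat => l /andP[l1 l2].
  rewrite -big_mkcond /= big_nat1_eq ifT //.
  have kl : (k * l < H * Q)%N by apply: ltn_mul.
  by rewrite /M -mulnA !muln_gt0 k1 l1 /= ltn_pmul2l.
apply: (@le_trans _ _ (\sum_(1 <= m < M) D * G m)); last first.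
  rewrite -big_distrr /= ler_wpM2l //.
  have [->|M0] := posnP M; first by rewrite !big_geq.
  by rewrite [leRHS]big_ltn // lerDr.
rewrite big_nat [leRHS]big_nat; apply: ler_sum => m mM.
apply: le_trans (ler_wpM2r (G0 m) (HD m mM)).
have m0 : (0 < m)%N by case/andP: mM.
apply: (@le_trans _ _ (\sum_(1 <= k < H) (if (k %| m)%N then G m else 0))).
  rewrite big_nat [leRHS]big_nat; apply: ler_sum => k /andP[k1 _].
  case: ifP => km; last first.
    rewrite big1 // => l _; case: eqP => // e.
    by move: km; rewrite e mulnCA dvdn_mulr.
  apply: (@le_trans _ _ (\sum_(1 <= l < Q) (if l == (m %/ (2 * k))%N then G m else 0))).
    apply: ler_sum => l _; case: eqP => [e|_]; last by case: ifP.
    by rewrite e mulnA mulKn ?muln_gt0 // eqxx -mulnA -e.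
  by rewrite -big_mkcond /= big_nat1_eq; case: ifP.
rewrite -big_mkcond big_const_seq /= iter_addr_0 -[_ *+ _]mulr_natl ler_wpM2r // ler_nat.
rewrite -size_filter; apply: uniq_leq_size; first by rewrite filter_uniq ?iota_uniq.
by move=> k; rewrite mem_filter -dvdn_divisors // => /andP[].
Qed.

Definition square_phase_sum (R : realType) (alpha : R) (A Q k : nat) : R :=
  \sum_(0 <= i < Q) cos (2 * pi * k%:R * alpha * (A + i)%:R ^+ 2).

(* The kernel [2 Q / (1 + Q |sin|)] stands for [min (Q, 1 / |sin|)]. *)
Definition min_inv_sin (R : realType) (alpha : R) (Q m : nat) : R :=
  2 * Q%:R / (1 + Q%:R * `|sin (pi * (m%:R * alpha))|).

(** Adding the squared sine sum gives a full squared modulus. Differencing by [l] makes the phase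
    linear in [i], so the inner sums are geometric. *)
Lemma square_phase_sum_sqr_le (R : realType) (alpha : R) (A Q k : nat) :
  square_phase_sum alpha A Q k ^+ 2 <=
    Q%:R + 2 * \sum_(1 <= l < Q) min_inv_sin alpha Q (2 * (k * l)).
Proof.
pose x i : R := 2 * pi * k%:R * alpha * (A + i)%:R ^+ 2.
apply: (@le_trans _ _ ((\sum_(0 <= i < Q) cos (x i)) ^+ 2 + (\sum_(0 <= i < Q) sin (x i)) ^+ 2)).
  by rewrite lerDl sqr_ge0.
rewrite sqr_sum_phase lerD2l ler_wpM2l //; apply: ler_sum => l _.
pose u : R := 2 * (pi * ((2 * (k * l))%:R * alpha)).
pose v : R := 2 * pi * k%:R * alpha * (2 * A%:R * l%:R + l%:R ^+ 2).
have -> : \sum_(0 <= i < Q - l) cos (x (i + l)%N - x i) =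
    \sum_(0 <= i < Q - l) cos (i%:R * u + v).
  apply: eq_bigr => i _; congr cos.
  by rewrite /x /u /v !natrD !natrM; ring.
have := norm_sum_cos_le (Q - l) u v.
have -> : u / 2 = pi * ((2 * (k * l))%:R * alpha) by rewrite /u mulrC mulKf.
set c := \sum_(0 <= i < _) _; rewrite /min_inv_sin; set s := `|sin _| => cs.
have s0 : 0 <= s by exact: normr_ge0.
have cQ : `|c| <= Q%:R.
  apply: le_trans (ler_norm_sum _ _ _) _.
  apply: (@le_trans _ _ (\sum_(0 <= i < Q - l) 1)).
    by apply: ler_sum => i _; exact: cos_max.
  by rewrite sumr_const_nat subn0 ler_nat leq_subr.
apply: le_trans (ler_norm _) _.
rewrite ler_pdivlMr; last by rewrite ltr_pwDl // mulr_ge0.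
(* Adding this to [|c| <= Q] gives [|c| (1 + Q s) <= 2 Q], the shape of [min_inv_sin]. *)
have : Q%:R * (`|c| * s) <= Q%:R * 1 by rewrite ler_wpM2l.
lra.
Qed.

(** For [h < H] the multiple [h x] is within [1 / 8] of the integer [h n]. Its phase is then within
    [1] of a multiple of [2 pi], and each cosine is at least [1 / 2]. *)
Lemma fejer_lower_bound (R : realType) (H : nat) (delta x : R) (n : int) :
  H%:R * delta <= 8^-1 -> `|x - n%:~R| <= delta ->
  H%:R ^+ 2 / 4 <= (\sum_(0 <= h < H) cos (h%:R * (2 * pi * x))) ^+ 2.
Proof.
move=> Hd xn.
have half : \sum_(0 <= h < H) 2^-1 <= \sum_(0 <= h < H) cos (h%:R * (2 * pi * x)).
  rewrite big_nat [leRHS]big_nat; apply: ler_sum => h /andP[_ hH].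
  pose w : R := h%:R * (2 * pi * (x - n%:~R)).
  have -> : h%:R * (2 * pi * x) = w + 2 * pi * (h%:Z * n)%:~R.
    by rewrite intrM -pmulrn /w; ring.
  rewrite cosD2pin; apply: le_trans (cos_ge_quad w).
  have hd : h%:R * `|x - n%:~R| <= 8^-1.
    by apply: le_trans Hd; rewrite ler_pM // ler_nat ltnW.
  have w1 : `|w| <= 1.
    have -> : `|w| = 2 * pi * (h%:R * `|x - n%:~R|).
      by rewrite /w !normrM (ger0_norm (pi_ge0 R)) !normr_nat; ring.
    have := pihalf_lt2 R => p2; have := pi_ge0 R => p0.
    have : 2 * pi * (h%:R * `|x - n%:~R|) <= 8 * 8^-1.
      by apply: ler_pM; rewrite ?mulr_ge0 //; lra.
    lra.
  have : `|w| * `|w| <= 1 * 1 by apply: ler_pM.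
  rewrite -normrM ger0_norm -?expr2 ?sqr_ge0 //; lra.
have hE : \sum_(0 <= h < H) 2^-1 = H%:R / 2 :> R.
  by rewrite sumr_const_nat subn0 mulr_natl.
have -> : H%:R ^+ 2 / 4 = (H%:R / 2) ^+ 2 :> R by field.
rewrite hE in half; have H2 : 0 <= (H%:R : R) / 2 by rewrite divr_ge0.
by rewrite lerXn2r ?nnegrE // (le_trans H2).
Qed.

Lemma count_near_int_le (R : realType) (alpha delta : R) (A Q H : nat) (P : pred nat) :
  (forall q, P q -> exists n : int, `|alpha * q%:R ^+ 2 - n%:~R| <= delta) ->
  (0 < H)%N -> H%:R * delta <= 8^-1 ->
  (count P (iota A Q))%:R <= 4 * (Q%:R / H%:R) +
     8 / H%:R * \sum_(1 <= k < H) `|square_phase_sum alpha A Q k|.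
Proof.
move=> near H0 Hd.
have HR : 0 < H%:R :> R by rewrite ltr0n.
pose th (q : nat) : R := 2 * pi * (alpha * q%:R ^+ 2).
(* [T] is [H] times the Fejer kernel: nonnegative everywhere and at least [H^2 / 4] at each counted
   [q]. *)
pose T q := (\sum_(0 <= h < H) cos (h%:R * th q)) ^+ 2 +
            (\sum_(0 <= h < H) sin (h%:R * th q)) ^+ 2.
have T0 q : 0 <= T q by rewrite addr_ge0 ?sqr_ge0.
set S := \sum_(1 <= k < H) _.
have lower : (count P (iota A Q))%:R * (H%:R ^+ 2 / 4) <= \sum_(q <- iota A Q) T q.
  rewrite mulr_natl -iter_addr_0 -big_const_seq big_mkcond /=.
  apply: ler_sum => q _; case: ifP => // /near[n hn].
  by apply: le_trans (fejer_lower_bound Hd hn) _; rewrite lerDl sqr_ge0.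
have upper : \sum_(q <- iota A Q) T q <= H%:R * Q%:R + 2 * (H%:R * S).
  (* The phase difference [k * th q] does not depend on [i], so each inner sum consists of [H - k]
     equal terms. *)
  have TE q : T q = H%:R + 2 * \sum_(1 <= k < H) (H - k)%:R * cos (k%:R * th q).
    rewrite /T (@sqr_sum_phase R H (fun h => h%:R * th q)); congr (_ + 2 * _).
    apply: eq_bigr => k _; rewrite mulr_natl.
    transitivity (\sum_(0 <= i < H - k) cos (k%:R * th q)); last first.
      by rewrite sumr_const_nat subn0.
    by apply: eq_bigr => i _; rewrite natrD; congr cos; ring.
  under eq_bigr do rewrite TE.
  rewrite big_split /= -big_distrr /= big_const_seq /= count_predT size_iota iter_addr_0.
  rewrite -[_ *+ Q]mulr_natr lerD2l ler_wpM2l // exchange_big /= big_distrr /=.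
  apply: ler_sum => k _; rewrite -big_distrr /=.
  have -> : \sum_(q <- iota A Q) cos (k%:R * th q) = square_phase_sum alpha A Q k.
    rewrite /square_phase_sum -[A in iota A]addn0 iotaDl big_map /index_iota subn0.
    by apply: eq_bigr => i _; rewrite /th; congr cos; ring.
  apply: le_trans (ler_norm _) _; rewrite normrM ger0_norm //.
  by rewrite ler_wpM2r // ler_nat leq_subr.
have := le_trans lower upper.
set N := (count _ _)%:R => NH.
have -> : 4 * (Q%:R / H%:R) + 8 / H%:R * S =
    (H%:R * Q%:R + 2 * (H%:R * S)) / (H%:R ^+ 2 / 4).
  by field; rewrite gt_eqF.
by rewrite ler_pdivlMr // divr_gt0 // exprn_gt0.
Qed.

Lemma sqr_sum_le (R : realFieldType) (H : nat) (a : nat -> R) : (0 < H)%N ->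
  (\sum_(1 <= k < H) a k) ^+ 2 <= H%:R * \sum_(1 <= k < H) a k ^+ 2.
Proof.
move=> H0; set S := \sum_(_ <= _ < _) a _.
have HR : 0 < H%:R :> R by rewrite ltr0n.
(* The Cauchy inequality comes from a variance. There are only [H - 1] terms, but replacing
   [(H - 1) y^2] by [H y^2] merely increases the sum and gives the factor [H]. *)
pose y := S / H%:R.
have : 0 <= \sum_(1 <= k < H) (a k - y) ^+ 2 by apply: sumr_ge0 => k _; exact: sqr_ge0.
have -> : \sum_(1 <= k < H) (a k - y) ^+ 2 =
   \sum_(1 <= k < H) a k ^+ 2 - 2 * y * S + (H - 1)%:R * y ^+ 2.
  rewrite /S [(H - 1)%:R * _]mulr_natl -sumr_const_nat big_distrr /= -sumrB -big_split /=.
  by apply: eq_bigr => k _; ring.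
rewrite natrB // => h.
have yE : y * H%:R = S by rewrite /y divfK // gt_eqF.
have y2 : 0 <= y ^+ 2 by exact: sqr_ge0.
have h2 : 0 <= H%:R * (\sum_(1 <= k < H) a k ^+ 2 - 2 * y * S + H%:R * y ^+ 2).
  by rewrite mulr_ge0 //; lra.
have e : H%:R * (\sum_(1 <= k < H) a k ^+ 2 - 2 * y * S + H%:R * y ^+ 2) =
  H%:R * (\sum_(1 <= k < H) a k ^+ 2) - S ^+ 2 by rewrite -yE; ring.
by rewrite e subr_ge0 in h2.
Qed.

(** * Reduction to squares close to integers *)

Section Counting.
Variables (R : realType) (Q : nat) (Delta alpha : R).
Hypothesis D0 : 0 <= Delta.

Let delta : R := 4 * Q%:R ^+ 2 * Delta.

(** Multiply the defining inequality by [q^2 <= (2 Q)^2]. *)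
Lemma square_farey_nearP (qa : int * int) : square_farey_near Q Delta alpha qa ->
  exists q : nat, [/\ qa.1 = q%:Z, q \in iota Q.+1 Q &
    `|qa.2%:~R - alpha * q%:R ^+ 2| <= delta].
Proof.
case: qa => [q a] [/andP[Qq qQ] _ near].
case: q Qq qQ near => [q|//] /= Qq qQ near.
exists q; split=> //; first by rewrite mem_iota; move: Qq qQ; lia.
have q0 : (0 < q)%N by move: Qq; lia.
have qR : 0 < q%:R ^+ 2 :> R by rewrite exprn_gt0 // ltr0n.
rewrite -pmulrn in near.
have -> : a%:~R - alpha * q%:R ^+ 2 = (a%:~R / q%:R ^+ 2 - alpha) * q%:R ^+ 2 :> R.
  by rewrite mulrBl divfK // gt_eqF.
rewrite normrM (ger0_norm (ltW qR)) /delta mulrC.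
apply: ler_pM => //.
have -> : 4 * Q%:R ^+ 2 = (2 * Q)%:R ^+ 2 :> R by rewrite natrM; ring.
by rewrite lerXn2r ?nnegrE // ler_nat; move: qQ; lia.
Qed.

Lemma Pcount_le_size (T : eqType) (f : int * int -> T) (t : seq T) :
  (forall x y, square_farey_near Q Delta alpha x -> square_farey_near Q Delta alpha y ->
     f x = f y -> x = y) ->
  (forall x, square_farey_near Q Delta alpha x -> f x \in t) ->
  (Pcount Q Delta alpha <= size t)%N.
Proof.
move=> finj ft; rewrite /Pcount.
set s := fset_set _.
have mem_s x : x \in s -> square_farey_near Q Delta alpha x.
  by rewrite in_fset_set ?inE //; exact: finite_square_farey_near.
rewrite -(size_map f); apply: uniq_leq_size.
  rewrite map_inj_in_uniq ?fset_uniq // => x y xs ys.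
  by apply: finj; exact: mem_s.
by move=> _ /mapP[x xs ->]; apply/ft/mem_s.
Qed.

(** For fixed [q] the numerator lies in an interval of length [2 delta]. Its offset from the floor
    [lo q] of the left end is an integer between [0] and [2 delta + 1]. *)
Lemma Pcount_le_trivial : (Pcount Q Delta alpha)%:R <= Q%:R * (2 * delta + 2).
Proof.
have d0 : 0 <= delta by rewrite !mulr_ge0.
pose lo (q : int) := Num.floor (alpha * q%:~R ^+ 2 - delta).
pose t := [seq (i, j) | i <- iota Q.+1 Q, j <- iota 0 (Num.truncn (2 * delta + 1)).+1].
pose f (x : int * int) := (`|x.1|%N, `|x.2 - lo x.1|%N).
have shift x : square_farey_near Q Delta alpha x ->
    0 <= x.2 - lo x.1 /\ (x.2 - lo x.1)%:~R <= 2 * delta + 1.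
  case/square_farey_nearP => q [qE _ near].
  have xq : x.1%:~R = q%:R :> R by rewrite qE -pmulrn.
  have := floor_itv (alpha * x.1%:~R ^+ 2 - delta).
  rewrite -/(lo x.1) intrD1 xq => /andP[h1 h2].
  move: near; rewrite ler_norml => /andP[n1 n2].
  have e : (x.2 - lo x.1)%:~R = x.2%:~R - (lo x.1)%:~R :> R by rewrite intrD mulrNz.
  by split; [rewrite -(ler0z R) e|rewrite e]; lra.
apply: (@le_trans _ _ (size t)%:R).
  rewrite ler_nat; apply: (Pcount_le_size (f := f)).
    move=> [q a] [q' a'] hx hy.
    have [px _] := shift _ hx; have [py _] := shift _ hy.
    have [n [/= qE _ _]] := square_farey_nearP hx.
    have [n' [/= qE' _ _]] := square_farey_nearP hy.
    rewrite /f => -[/= e1 e2].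
    have qq : q' = q by move: e1; rewrite qE qE' /= => ->.
    move: px py e2; rewrite /= qq => px py e2.
    congr (_, _); move: e2 px py; lia.
  move=> x hx; have [n [qE nI _]] := square_farey_nearP hx.
  have [s0 s1] := shift _ hx.
  apply/allpairsP; exists (f x); split; first by rewrite /f /= qE.
    rewrite mem_iota leq0n add0n ltnS andTb.
    rewrite truncn_ge_nat; last by lra.
    by move: s0 s1; rewrite /f /=; case: (x.2 - lo x.1) => // k _; rewrite -pmulrn.
  by rewrite /f.
rewrite size_allpairs !size_iota natrM ler_wpM2l // -natr1.
have h : 0 <= 2 * delta + 1 by lra.
have /andP[h1 _] := truncn_itv h.
lra.
Qed.

(** Two numerators for one [q] differ by at most [2 delta < 1], so [q] determines [a]. *)
Lemma Pcount_le_count : delta <= 8^-1 ->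
  (Pcount Q Delta alpha <=
    count (fun q : nat => `[< exists n : int, (`|alpha * q%:R ^+ 2 - n%:~R| <= delta)%R >])
      (iota Q.+1 Q))%N.
Proof.
move=> d8; rewrite -size_filter.
apply: (Pcount_le_size (f := fun x => `|x.1|%N)).
  move=> [q a] [q' a'] /square_farey_nearP[n [/= -> _ h]].
  move=> /square_farey_nearP[n' [/= -> _ h']] /= e; move: h'; rewrite -e => h'.
  congr (_, _); apply/eqP; rewrite -subr_eq0 -absz_eq0 -leqn0 -ltnS.
  rewrite -ltz_nat abszE -(ltr_int R) intr_norm intrD mulrNz.
  move: h h'; rewrite !ler_norml => /andP[h1 h2] /andP[h3 h4].
  by rewrite ltr_norml; apply/andP; split; lra.
move=> x /square_farey_nearP[n [-> nI h]].
rewrite mem_filter nI andbT; apply/asboolP; exists x.2.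
by rewrite distrC.
Qed.

End Counting.

(** * The mean square estimate *)

(** Cauchy, differencing and the grouping by products lead to a sum of [min_inv_sin] over
    [m < 2 H Q], to which the bucket estimate applies with [X = 2 Q] and [c = 2]. *)
Lemma mean_square_phase_sum_le (R : realType) (alpha z D : R) (b : int) (r H Q A : nat) :
  alpha = b%:~R / r%:R + z -> (0 < r)%N -> coprimez b r%:Z ->
  `|z| <= (r%:R ^+ 2)^-1 -> (0 < H)%N -> 0 <= D ->
  (forall m, (0 < m < 2 * H * Q)%N -> (size (divisors m))%:R <= D) ->
  (H%:R^-1 * \sum_(1 <= k < H) `|square_phase_sum alpha A Q k|) ^+ 2 <=
    Q%:R + 2 * D * (4 * Q%:R / r%:R + H%:R^-1) *
      (4 * Q%:R + 16 * r%:R * (1 + ln (2 * r%:R))).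
Proof.
move=> aE r0 cbr zr H0 D0 HD.
have HR : 0 < H%:R :> R by rewrite ltr0n.
have rR : 0 < r%:R :> R by rewrite ltr0n.
set S := \sum_(_ <= _ < _) _; set Lr := 1 + ln _.
set W := \sum_(1 <= k < H) \sum_(1 <= l < Q) min_inv_sin alpha Q (2 * (k * l)).
have den0 m : 0 < 1 + Q%:R * `|sin (pi * (m%:R * alpha))| :> R.
  by rewrite ltr_pwDl // mulr_ge0.
have G0 m : 0 <= min_inv_sin alpha Q m.
  by rewrite /min_inv_sin divr_ge0 ?mulr_ge0 // ltW.
have GX m : min_inv_sin alpha Q m <= 2 * Q%:R.
  by rewrite /min_inv_sin ler_pdivrMr // ler_peMr ?mulr_ge0 // lerDl mulr_ge0.
have Gs m : min_inv_sin alpha Q m * `|sin (pi * (m%:R * alpha))| <= 2.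
  rewrite /min_inv_sin mulrAC ler_pdivrMr //.
  by have := normr_ge0 (sin (pi * (m%:R * alpha))); lra.
have Q2 : 0 <= 2 * Q%:R :> R by rewrite mulr_ge0.
have W_le : W <= D * ((4 * (H%:R * Q%:R) / r%:R + 1) * (4 * Q%:R + 16 * r%:R * Lr)).
  apply: le_trans (sum_mul_pairs_le G0 D0 HD) _; rewrite ler_wpM2l //.
  have := sum_min_inv_sin_le aE r0 cbr zr Q2 (ler0n R 2) GX G0 Gs (2 * H * Q).
  move/le_trans; apply; rewrite !natrM -/Lr le_eqVlt; apply/orP; left; apply/eqP.
  by field; exact: lt0r_neq0.
have S2 : S ^+ 2 <= H%:R * (H%:R * Q%:R + 2 * W).
  apply: le_trans (sqr_sum_le _ H0) _; rewrite ler_wpM2l //.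
  apply: (@le_trans _ _ (\sum_(1 <= k < H)
      (Q%:R + 2 * \sum_(1 <= l < Q) min_inv_sin alpha Q (2 * (k * l))))).
    apply: ler_sum => k _; rewrite real_normK ?num_real //.
    exact: square_phase_sum_sqr_le.
  rewrite big_split /= -big_distrr /= sumr_const_nat lerD2r -[_ *+ _]mulr_natl.
  by rewrite ler_wpM2r // ler_nat leq_subr.
have -> : (H%:R^-1 * S) ^+ 2 = S ^+ 2 / H%:R ^+ 2 by field; exact: lt0r_neq0.
rewrite ler_pdivrMr ?exprn_gt0 //; apply: (le_trans S2).
have : 2 * H%:R * W <= 2 * H%:R *
    (D * ((4 * (H%:R * Q%:R) / r%:R + 1) * (4 * Q%:R + 16 * r%:R * Lr))).
  by rewrite ler_wpM2l // mulr_ge0.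
set E := 4 * Q%:R + 16 * r%:R * Lr.
have -> : (Q%:R + 2 * D * (4 * Q%:R / r%:R + H%:R^-1) * E) * H%:R ^+ 2 =
  H%:R * (H%:R * Q%:R) + 2 * H%:R * (D * ((4 * (H%:R * Q%:R) / r%:R + 1) * E)) :> R.
  by field; rewrite !lt0r_neq0.
lra.
Qed.

(** * Choice of the kernel length and assembly of the final bound *)

Lemma sqr_sum4_ge (R : realDomainType) (a b c d : R) :
  0 <= a -> 0 <= b -> 0 <= c -> 0 <= d ->
  a ^+ 2 + b ^+ 2 + c ^+ 2 + d ^+ 2 <= (a + b + c + d) ^+ 2.
Proof.
move=> a0 b0 c0 d0.
have : 0 <= a * b + a * c + a * d + b * c + b * d + c * d.
  by rewrite !addr_ge0 // mulr_ge0.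
move=> h.
have -> : (a + b + c + d) ^+ 2 =
  a ^+ 2 + b ^+ 2 + c ^+ 2 + d ^+ 2 + 2 * (a * b + a * c + a * d + b * c + b * d + c * d) by ring.
by rewrite lerDl mulr_ge0.
Qed.

(** Rounding down loses at most a factor [2]: as [H >= 1], one has [1 / (8 d) < H + 1 <= 2 H]. *)
Lemma truncn_inv_bounds (R : realType) (d : R) : 0 < d -> d <= 8^-1 ->
  let H := Num.truncn (8 * d)^-1 in
  [/\ (0 < H)%N, H%:R * d <= 8^-1 & H%:R^-1 <= 16 * d].
Proof.
move=> d0 d8 H.
have d8' : 0 < 8 * d by lra.
have x1 : 1 <= (8 * d)^-1 by rewrite invf_ge1 //; lra.
have /andP[h1 h2] : H%:R <= (8 * d)^-1 < H.+1%:R by apply: truncn_itv; lra.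
have H0 : (0 < H)%N by rewrite truncn_gt0.
have HR : 1 <= H%:R :> R by rewrite ler1n.
split=> //.
  have : H%:R * (8 * d) <= 1 by rewrite -ler_pdivlMr // div1r.
  lra.
have h3 : 1 < H.+1%:R * (8 * d) by rewrite -ltr_pdivrMr // div1r.
rewrite -natr1 in h3.
rewrite -div1r ler_pdivrMr; last by lra.
have : 1 * d <= H%:R * d by rewrite ler_wpM2r // ltW.
lra.
Qed.

Lemma powR32_sqr (R : realType) (x : R) : 0 <= x -> (x `^ (3 / 2)) ^+ 2 = x ^+ 3.
Proof.
move=> x0; rewrite -powR_mulrn ?powR_ge0 // -powRrM.
by rewrite mulfVK ?pnatr_eq0 // powR_mulrn.
Qed.

(** The two factors are at most [64 (q/r + q^2 Delta)] and [16 B' Y (q + r)]. The product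
    [(q/r + q^2 Delta) (q + r)] expands exactly into the four terms on the right, and
    [2048 = 2 * 64 * 16]. *)
Lemma weyl_terms_le (R : realFieldType) (B B' Y q r Delta hinv L : R) :
  1 <= B * B' -> 0 <= B -> 1 <= Y -> 1 <= B' * Y -> 0 < q -> 0 < r -> 0 <= Delta ->
  0 <= hinv -> hinv <= 64 * (q ^+ 2 * Delta) -> 0 <= L -> L <= B' * Y ->
  q + 2 * (B * Y) * (4 * q / r + hinv) * (4 * q + 16 * r * L) <=
    (1 + 2048 * (B * B')) * Y ^+ 2 *
      (q ^+ 2 / r + q + q ^+ 2 * (r * Delta) + q ^+ 3 * Delta).
Proof.
move=> BB' B0 Y1 BY1 q0 r0 D0 h0 hle L0 Lle.
have Y0 : 0 <= Y by rewrite (le_trans ler01).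
have BY0 : 0 <= 2 * (B * Y) by rewrite !mulr_ge0.
have qr : 0 <= q / r by rewrite divr_ge0 // ltW.
have rL : 0 <= 16 * r * L by rewrite !mulr_ge0 // ltW.
have f1 : 4 * q / r + hinv <= 64 * (q / r + q ^+ 2 * Delta).
  by rewrite -mulrA mulrDr lerD // ler_wpM2r // ler_nat.
have f2 : 4 * q + 16 * r * L <= 16 * (B' * Y) * (q + r).
  have h1 : r * L <= r * (B' * Y) by rewrite ler_wpM2l // ltW.
  have h2 : q * 1 <= q * (B' * Y) by rewrite ler_wpM2l // ltW.
  clear -h1 h2 q0 r0; lra.
have f3 : (4 * q / r + hinv) * (4 * q + 16 * r * L) <=
    64 * (q / r + q ^+ 2 * Delta) * (16 * (B' * Y) * (q + r)).
  apply: ler_pM => //; apply: addr_ge0 => //; last by rewrite mulr_ge0 // ltW.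
  by rewrite -mulrA mulr_ge0.
set F := q ^+ 2 / r + _ + _ + _.
have qF : q <= F.
  have h1 : 0 <= q ^+ 2 / r by rewrite divr_ge0 ?exprn_ge0 // ltW.
  have h2 : 0 <= q ^+ 2 * (r * Delta) by rewrite !mulr_ge0 ?exprn_ge0 // ltW.
  have h3 : 0 <= q ^+ 3 * Delta by rewrite !mulr_ge0 ?exprn_ge0 // ltW.
  by rewrite /F -!addrA addrCA lerDl !addr_ge0.
have -> : (1 + 2048 * (B * B')) * Y ^+ 2 * F = Y ^+ 2 * F + 2048 * (B * B') * Y ^+ 2 * F by ring.
apply: lerD.
  apply: (le_trans qF); rewrite ler_peMl ?exprn_ege1 //.
  by apply: le_trans qF; apply: ltW.
have -> : 2048 * (B * B') * Y ^+ 2 * F =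
    2 * (B * Y) * (64 * (q / r + q ^+ 2 * Delta) * (16 * (B' * Y) * (q + r))).
  by rewrite /F; field; exact: lt0r_neq0.
by rewrite -[leLHS]mulrA ler_wpM2l.
Qed.

Theorem theorem2 (R : realType) (eps : R) (eps_gt0 : 0 < eps) :
  exists2 C : R, 0 < C &
    forall (Q : nat) (Delta : R),
      (0 < Q)%N -> 0 < Delta -> Delta <= 2^-1 ->
      let tau := Delta `^ (- 2^-1) in
      forall (alpha z : R) (b : int) (r : nat),
        alpha = b%:~R / r%:R + z ->
        (0 < r)%N -> r%:R <= tau ->
        coprimez b r%:Z ->
        `|z| <= (r%:R * tau)^-1 ->
        (Pcount Q Delta alpha)%:R <=
          C * (Q%:R ^+ 3 * Delta +
               (Q%:R * Delta^-1) `^ eps *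
                 (Q%:R / Num.sqrt r%:R + Num.sqrt Q%:R
                  + Q%:R * Num.sqrt (r%:R * Delta)
                  + Q%:R `^ (3 / 2) * Num.sqrt Delta)).
Proof.
have [B B1 HB] := divisor_bound eps_gt0.
have B0 : 0 <= B := le_trans ler01 B1.
pose B' : R := 1 + eps^-1.
have B'1 : 1 <= B' by rewrite lerDl invr_ge0 ltW.
pose K : R := 1 + 2048 * (B * B').
have BB' : 1 <= B * B' by apply: mulr_ege1.
have K1 : 1 <= K by rewrite /K; lra.
have K0 : 0 <= K := le_trans ler01 K1.
(* [256 = 4 * 64] comes from [4 Q / H] with [1 / H <= 64 Q^2 Delta], and [8 K] from the exponential
   sums. *)
exists (256 + 8 * K); first by lra.
move=> Q Delta Q0 D0 D2 tau alpha z b r aE r0 rtau cbr hz.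
have QR : 1 <= Q%:R :> R by rewrite ler1n.
have rR : 1 <= r%:R :> R by rewrite ler1n.
have QR0 : 0 < Q%:R :> R by rewrite ltr0n.
have rR0 : 0 < r%:R :> R by rewrite ltr0n.
set Y := (Q%:R * Delta^-1) `^ eps.
have QD1 : 1 <= Q%:R * Delta^-1 by rewrite ler_pdivlMr //; clear -D2 QR; lra.
have Y1 : 1 <= Y.
  by have := ler_powR QD1 (ltW eps_gt0); rewrite powRr0.
have Y0 : 0 <= Y := le_trans ler01 Y1.
set G := _ + _ + _ + _.
have G0 : 0 <= G.
  by rewrite /G !addr_ge0 ?mulr_ge0 ?invr_ge0 ?sqrtr_ge0 ?powR_ge0.
set Fs := Q%:R ^+ 2 / r%:R + Q%:R + Q%:R ^+ 2 * (r%:R * Delta) + Q%:R ^+ 3 * Delta.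
(* The mean square estimate produces the squares of the four terms of [G]; this comparison allows a
   single root to be taken at the end. *)
have FsG : Fs <= G ^+ 2.
  have D0' := ltW D0; have rD0 : 0 <= r%:R * Delta by rewrite mulr_ge0.
  have s1 : (Q%:R / Num.sqrt r%:R) ^+ 2 = Q%:R ^+ 2 / r%:R :> R.
    by rewrite expr_div_n sqr_sqrtr.
  have s2 : Num.sqrt Q%:R ^+ 2 = Q%:R :> R by rewrite sqr_sqrtr.
  have s3 : (Q%:R * Num.sqrt (r%:R * Delta)) ^+ 2 = Q%:R ^+ 2 * (r%:R * Delta) :> R.
    by rewrite exprMn sqr_sqrtr.
  have s4 : (Q%:R `^ (3 / 2) * Num.sqrt Delta) ^+ 2 = Q%:R ^+ 3 * Delta :> R.
    by rewrite exprMn powR32_sqr // sqr_sqrtr.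
  rewrite /Fs -s1 -[X in _ + X + _ + _]s2 -s3 -s4.
  by apply: sqr_sum4_ge; rewrite ?mulr_ge0 ?invr_ge0 ?sqrtr_ge0 ?powR_ge0.
clearbody G.
have Q3D : 0 <= Q%:R ^+ 3 * Delta by rewrite mulr_ge0 ?exprn_ge0 // ltW.
have KQ : 0 <= K * (Q%:R ^+ 3 * Delta) by rewrite mulr_ge0.
have YG : 0 <= Y * G by rewrite mulr_ge0.
have KYG : 0 <= K * (Y * G) by rewrite mulr_ge0.
set delta := 4 * Q%:R ^+ 2 * Delta.
have delta0 : 0 < delta by rewrite /delta !mulr_gt0 // exprn_gt0.
have QdE : Q%:R * delta = 4 * (Q%:R ^+ 3 * Delta) by rewrite /delta; ring.
(* For [delta > 1 / 8], [Q (2 delta + 2) <= 18 Q delta = 72 Q^3 Delta]. *)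
have [d8|d8] := leP delta 8^-1; last first.
  have := @Pcount_le_trivial R Q Delta alpha (ltW D0); rewrite -/delta.
  have : Q%:R * 8^-1 <= Q%:R * delta by rewrite ler_wpM2l // ltW.
  clear -QdE KQ KYG YG Q3D; lra.
pose H := Num.truncn (8 * delta)^-1.
have [H0 Hd Hinv] := truncn_inv_bounds delta0 d8; rewrite -/H in H0 Hd Hinv.
have QQ : 1 <= Q%:R ^+ 2 :> R by apply: exprn_ege1.
have D32 : Delta <= 32^-1.
  have : 1 * Delta <= Q%:R ^+ 2 * Delta by rewrite ler_wpM2r // ltW.
  by move: d8; rewrite /delta; clear; lra.
pose D := B * Y.
(* Since [H delta <= 1 / 8], every such [m] is at most [Q / Delta], so the divisor bound costs at
   most [B * Y]. *)
have D_ge m : (0 < m < 2 * H * Q)%N -> (size (divisors m))%:R <= D.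
  move=> /andP[m0 mM]; apply: le_trans (HB m m0) _; rewrite ler_wpM2l //.
  apply: ge0_ler_powR; rewrite ?nnegrE //; [exact: ltW|exact: le_trans QD1|].
  rewrite ler_pdivlMr //.
  have mle : m%:R <= 2 * H%:R * Q%:R :> R by rewrite -!natrM ler_nat ltnW.
  have : m%:R * Delta <= 2 * H%:R * Q%:R * Delta by rewrite ler_wpM2r // ltW.
  have HdE : 2 * H%:R * Q%:R * Delta * (2 * Q%:R) = H%:R * delta by rewrite /delta; ring.
  have HQ0 : 0 <= 2 * H%:R * Q%:R * Delta by rewrite !mulr_ge0 // ltW.
  have : 2 * H%:R * Q%:R * Delta * 1 <= 2 * H%:R * Q%:R * Delta * (2 * Q%:R).
    by rewrite ler_wpM2l //; clear -QR; lra.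
  clear -HdE Hd HQ0 QR; lra.
have r2D : r%:R ^+ 2 * Delta <= 1.
  have tau2 : tau ^+ 2 = Delta^-1.
    by rewrite /tau powRN exprVn powR12_sqrt ?sqr_sqrtr // ltW.
  rewrite -ler_pdivlMr // div1r -tau2 lerXn2r ?nnegrE //; exact: powR_ge0.
have L_le : 1 + ln (2 * r%:R) <= B' * Y.
  (* From [r^2 Delta <= 1] and [Delta <= 1 / 32] one gets [(2 r Delta)^2 <= 1 / 8], so the logarithm
     is also absorbed by [Y]. *)
  have r2Q : 2 * r%:R <= Q%:R * Delta^-1.
    rewrite ler_pdivlMr //; apply: le_trans QR.
    have x0 : 0 <= 2 * r%:R * Delta by rewrite !mulr_ge0 // ltW.
    rewrite -(@ler_pXn2r _ 2) ?nnegrE // expr1n.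
    have -> : (2 * r%:R * Delta) ^+ 2 = 4 * Delta * (r%:R ^+ 2 * Delta) by ring.
    have : 4 * Delta * (r%:R ^+ 2 * Delta) <= 4 * Delta * 1.
      by rewrite ler_wpM2l // mulr_ge0 // ltW.
    clear -D32; lra.
  have r2 : 0 < 2 * r%:R :> R by rewrite mulr_gt0.
  have := ln_le_powR eps_gt0 r2.
  have : eps^-1 * (2 * r%:R) `^ eps <= eps^-1 * Y.
    rewrite ler_wpM2l ?invr_ge0 //; first exact: ltW.
    apply: (ge0_ler_powR (ltW eps_gt0)); rewrite ?nnegrE // ?(ltW r2) //.
    exact: le_trans QD1.
  by rewrite /B'; clear -Y1; lra.
have L0 : 0 <= ln (2 * r%:R) :> R by rewrite ln_ge0 //; clear -rR; lra.
(* As [r <= tau], the hypothesis on [z] implies the weaker bound used for the buckets. *)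
have zr : `|z| <= (r%:R ^+ 2)^-1.
  apply: (le_trans hz); rewrite lef_pV2 ?posrE ?mulr_gt0 ?exprn_gt0 //.
    by rewrite expr2 ler_wpM2l // ltW.
  exact: lt_le_trans rtau.
set T := H%:R^-1 * \sum_(1 <= k < H) `|square_phase_sum alpha Q.+1 Q k|.
have D_ge0 : 0 <= D by rewrite mulr_ge0.
have T2 : T ^+ 2 <= Q%:R + 2 * D * (4 * Q%:R / r%:R + H%:R^-1) *
    (4 * Q%:R + 16 * r%:R * (1 + ln (2 * r%:R))).
  exact: mean_square_phase_sum_le aE r0 cbr zr H0 D_ge0 D_ge.
have HQ2 : H%:R^-1 <= 64 * (Q%:R ^+ 2 * Delta) by move: Hinv; rewrite /delta; clear; lra.
have BY1 : 1 <= B' * Y by apply: mulr_ege1.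
have T2' : T ^+ 2 <= K * Y ^+ 2 * Fs.
  apply: (le_trans T2); apply: weyl_terms_le => //.
  - exact: ltW.
  - by rewrite addr_ge0.
have TG : T <= K * (Y * G).
  have T0 : 0 <= T by rewrite mulr_ge0 ?invr_ge0 // sumr_ge0.
  rewrite -(@ler_pXn2r _ 2) ?nnegrE //; apply: (le_trans T2').
  (* Squaring yields [K^2] where only [K] is required; [K >= 1] closes the gap. *)
  have -> : (K * (Y * G)) ^+ 2 = K * (K * Y ^+ 2 * G ^+ 2) by ring.
  have Y20 : 0 <= K * Y ^+ 2 by rewrite mulr_ge0 ?exprn_ge0.
  have : K * Y ^+ 2 * Fs <= 1 * (K * Y ^+ 2 * G ^+ 2) by rewrite mul1r ler_wpM2l.
  move/le_trans; apply; rewrite ler_wpM2r // mulr_ge0 // exprn_ge0 //.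
have near q : `[< exists n : int, `|alpha * q%:R ^+ 2 - n%:~R| <= delta >] ->
   exists n : int, `|alpha * q%:R ^+ 2 - n%:~R| <= delta by move/asboolP.
have := @count_near_int_le R alpha delta Q.+1 Q H _ near H0 Hd.
have := @Pcount_le_count R Q Delta alpha (ltW D0) d8.
rewrite -/delta -(ler_nat R) => /le_trans h1 /h1.
rewrite -[8 / _ * _]mulrA -/T.
have : Q%:R * H%:R^-1 <= Q%:R * (64 * (Q%:R ^+ 2 * Delta)) by rewrite ler_wpM2l.
have -> : Q%:R * (64 * (Q%:R ^+ 2 * Delta)) = 64 * (Q%:R ^+ 3 * Delta) by ring.
clear -TG KQ KYG YG Q3D; lra.
Qed.
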